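(* Let $K$ be a positive integer, $\mathcal I=\{1,2\}$, $\mathcal K=\{1,\dots,K\}$. For $i\in\mathcal I$, $k\in\mathcal K$ let $$V_{(i-1)K+k}(P_{1,k},P_{2,k},B_k)=\left(\mathbb{E}_{\gamma_k}\left\{e^{-\theta_{i,k}B_kT_c\log\left(1+\frac{P_{i,k}\gamma_k}{N_0B_k+\mu_{3-i,k}P_{3-i,k}}\right)}\right\}\right)^{-1}.$$ Call $(\mathbf P_1,\mathbf P_2,\mathbf B)$, with $\mathbf P_i=(P_{i,k})_{k\in\mathcal K}$ and $\mathbf B=(B_k)_{k\in\mathcal K}$, admissible if $0\le P_{i,k}\le P_{i,k}^{max}$ and $B_k\ge 0$ for all $i\in\mathcal I$, $k\in\mathcal K$, and $\sum_{k=1}^K B_k\le B$. Let $\mathcal G$ be the set of all $\mathbf Y=(Y_1,\dots,Y_{2K})$ for which there is an admissible $(\mathbf P_1,\mathbf P_2,\mathbf B)$ with $0\le Y_{(i-1)K+k}\le V_{(i-1)K+k}(P_{1,k},P_{2,k},B_k)$ for all $i\in\mathcal I$, $k\in\mathcal K$. Then an upper boundary point $\mathbf V^u$ of $\mathcal G$, with $V_{(i-1)K+k}(P_{1,k},P_{2,k},B_k)=V^u_{(i-1)K+k}$ for all $i\in\mathcal I$ and $k\in\mathcal K$ for an admissible $(\mathbf P_1,\mathbf P_2,\mathbf B)$, only occurs when $\sum_{k=1}^K B_k=B$ and at least one power value is at its maximum level, i.e., $P_{1,k}=P_{1,k}^{max}$ or $P_{2,k}=P_{2,k}^{max}$, for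 all $k\in\mathcal K$.
   Context: A set $\mathcal G\subset\mathbb{R}_+^n$ ($\mathbb{R}_+$ the nonnegative reals) is normal if $\mathbf x\in\mathcal G$ and $\mathbf 0\le\mathbf x'\le\mathbf x$ (componentwise) imply $\mathbf x'\in\mathcal G$. An element $\bar{\mathbf x}$ of a normal closed set $\mathcal G$ is an upper boundary point of $\mathcal G$ if $\mathcal G\cap\{\mathbf x\in\mathbb{R}_+^n : \mathbf x>\bar{\mathbf x}\}=\emptyset$, where $\mathbf x>\bar{\mathbf x}$ means $x_j>\bar x_j$ for all $j$. Here $n=2K$, and $\mathcal G$ is regarded as a compact normal set. The setting is $K$ pairs of full-duplex users sharing a total bandwidth $B>0$. Pair $k$ uses bandwidth $B_k$, and its users $i=1,2$ transmit with powers $P_{i,k}$, at most $P_{i,k}^{max}$. $\gamma_k$ is the (nonnegative, random) channel power gain of pair $k$, $N_0>0$ the noise power spectral density, $\mu_{i,k}\in(0,1]$ the self-interference suppression factors, $T_c>0$ the channel coherence time, and $\theta_{i,k}>0$ the delay quality-of-service exponents. $\mathbb{E}_{\gamma_k}$ denotes expectation with respect to $\gamma_k$, and $\log$ is a logarithm whose base is not specified.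
   Formalization: Assumes all P_{i,k}^max > 0 and each γ_k > 0 with positive probability (else ΣB_k = B fails); the power claim is for pairs with B_k > 0 (powers are arbitrary when B_k = 0), and V^u is also attained, with the same B_k, by powers meeting the claim for all k. *)

(* Defs.v *)
From HB Require Import structures.
From mathcomp Require Import all_boot all_order all_algebra.
From mathcomp Require Import all_classical all_reals all_analysis.
Set Implicit Arguments.
Unset Strict Implicit.
Unset Printing Implicit Defensive.
Import Order.TTheory GRing.Theory Num.Theory.
Import numFieldNormedType.Exports.
Local Open Scope classical_set_scope.
Local Open Scope ring_scope.

(* Users and pairs are numbered from 0: i : 'I_2, k : 'I_K. The other user of
   a pair (3 - i when counting from 1) is [rev_ord i]. *)

Lemma flat_index_subproof (K : nat) (i : 'I_2) (k : 'I_K) :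
  (i * K + k < 2 * K)%N.
Proof.
case: i => [[|[|//]] ?] /=.
  by rewrite mul0n add0n (leq_trans (ltn_ord k)) // leq_pmull.
by rewrite mul1n mul2n -addnn ltn_add2l.
Qed.

(* 0-based counterpart of (i - 1) K + k. *)
Definition flat_index (K : nat) (i : 'I_2) (k : 'I_K) : 'I_(2 * K) :=
  Ordinal (flat_index_subproof i k).

Definition upper_boundary_point (R : realType) (n : nat)
    (G : set 'rV[R]_n) (xbar : 'rV[R]_n) : Prop :=
  G xbar /\
  G `&` [set x | (forall j, 0 <= x 0 j) /\ (forall j, xbar 0 j < x 0 j)] = set0.

Definition logb (R : realType) (b x : R) : R := ln x / ln b.

(* p i is the power of user i of pair k and w the bandwidth of the pair. The
   denominator can vanish only if w = 0, where the exponent is 0 anyway,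
   in accordance with the limit w -> 0. For nonnegative p, w and gamma k the
   integrand takes values in ]0, 1], so the expectation is finite and positive
   and [fine] loses nothing. *)
Definition V (R : realType) d (T : measurableType d) (Pr : probability T R)
    (K : nat) (b N0 Tc : R) (theta mu : 'I_2 -> 'I_K -> R)
    (gamma : 'I_K -> {RV Pr >-> R}) (i : 'I_2) (k : 'I_K)
    (p : 'I_2 -> R) (w : R) : R :=
  (fine 'E_Pr[fun x : T =>
     expR (- theta i k * w * Tc *
       logb b (1 + p i * gamma k x /
                   (N0 * w + mu (rev_ord i) k * p (rev_ord i))))])^-1.

Definition admissible (R : realType) (K : nat) (Pmax : 'I_2 -> 'I_K -> R)
    (Btot : R) (P : 'I_2 -> 'I_K -> R) (Bw : 'I_K -> R) : Prop :=
  [/\ forall i k, 0 <= P i k <= Pmax i k,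
      forall k, 0 <= Bw k
    & \sum_(k < K) Bw k <= Btot].

Definition G (R : realType) d (T : measurableType d) (Pr : probability T R)
    (K : nat) (b N0 Tc Btot : R) (theta mu Pmax : 'I_2 -> 'I_K -> R)
    (gamma : 'I_K -> {RV Pr >-> R}) : set 'rV[R]_(2 * K) :=
  [set Y | exists (P : 'I_2 -> 'I_K -> R) (Bw : 'I_K -> R),
     admissible Pmax Btot P Bw /\
     forall i k, 0 <= Y 0 (flat_index i k)
                   <= V b N0 Tc theta mu gamma i k (P^~ k) (Bw k)].

(* Main.v *)
(** The set [G] consists of the vectors below some admissible value vector, so
    an admissible value vector is an upper boundary point exactly when no
    admissible allocation improves all of its components strictly. The rate
    w log (1 + p g / (N0 w + m q)) increases strictly with the bandwidth w,
    because w |-> w log (1 + a / w) does by strict concavity of log, and it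
    increases strictly when p and q are multiplied by the same factor > 1.
    Unused bandwidth could therefore be shared out to improve every user, and a
    pair below both of its power limits could raise both powers proportionally
    and release bandwidth without loss. Users with zero power have the value 1
    whatever happens; they are given a little power at the end, which by
    continuity (dominated convergence) does not cancel the other gains. *)

Require Import Defs.
From HB Require Import structures.
From mathcomp Require Import all_boot all_order all_algebra.
From mathcomp Require Import all_classical all_reals all_analysis.
From mathcomp Require Import measurable_realfun ring lra.
Import Order.TTheory GRing.Theory Num.Theory.
Import numFieldNormedType.Exports.
Local Open Scope classical_set_scope.
Local Open Scope ring_scope.

Set Implicit Arguments.
Unset Strict Implicit.
Unset Printing Implicit Defensive.

(** * Expectations of random variables with values in [0, 1] *)

Lemma integrable_unit_interval (R : realType) (d : measure_display)
    (T : measurableType d) (Pr : probability T R) (f : T -> R) :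
  measurable_fun setT f -> (forall x, 0 <= f x <= 1) ->
  Pr.-integrable setT (EFin \o f).
Proof.
move=> mf f01; apply: measurable_bounded_integrable => //.
  by rewrite ltey_eq fin_num_measure.
exists 1; split => // M M1 x _ /=.
by have /andP[f0 f1] := f01 x; rewrite ger0_norm // (le_trans f1) // ltW.
Qed.

(** If the expectations were equal, the nonnegative difference [g - f] would have integral 0 and
    vanish almost everywhere, which puts [A] inside a null set. *)
Lemma lt_expectation (R : realType) (d : measure_display)
    (T : measurableType d) (Pr : probability T R) (f g : T -> R) (A : set T) :
  measurable_fun setT f -> measurable_fun setT g ->
  (forall x, 0 <= f x <= 1) -> (forall x, 0 <= g x <= 1) ->
  (forall x, f x <= g x) -> (forall x, A x -> f x < g x) ->
  measurable A -> (0 < Pr A)%E ->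
  fine 'E_Pr[f] < fine 'E_Pr[g].
Proof.
move=> mf mg f01 g01 fg fgA mA PA.
have If := integrable_unit_interval Pr mf f01.
have Ig := integrable_unit_interval Pr mg g01.
have Ff : ('E_Pr[f] \is a fin_num)%E.
  by rewrite unlock; exact: integrable_fin_num.
have Fg : ('E_Pr[g] \is a fin_num)%E.
  by rewrite unlock; exact: integrable_fin_num.
have Egf : (\int[Pr]_x (g x - f x)%:E = 'E_Pr[g] - 'E_Pr[f])%E.
  by rewrite unlock -integralB.
have /measurable_EFinP mgf := measurable_funB mg mf.
have gf0 x : (0 <= (g x - f x)%:E)%E by rewrite lee_fin subr_ge0.
apply: fine_lt => //; rewrite -sube_gt0 // -Egf lt0e integral_ge0 // andbT.
apply/eqP => int0.
have /(ae_eq_integral_abs Pr measurableT mgf) :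
    (\int[Pr]_x `|(g x - f x)%:E| = 0)%E.
  by rewrite -[RHS]int0; apply: eq_integral => x _; rewrite gee0_abs ?gf0.
move=> [N [mN N0 AN]].
have : (Pr A <= Pr N)%E.
  apply: le_measure; rewrite ?inE // => x Ax; apply: AN => /= /(_ I) [] /eqP.
  by rewrite subr_eq0 => /eqP gfx; have := fgA x Ax; rewrite gfx ltxx.
by rewrite N0 leNgt PA.
Qed.

Lemma cvg_expectation (R : realType) (d : measure_display)
    (T : measurableType d) (Pr : probability T R)
    (f_ : nat -> T -> R) (f : T -> R) :
  (forall n, measurable_fun setT (f_ n)) ->
  (forall n x, 0 <= f_ n x <= 1) -> measurable_fun setT f ->
  (forall x, 0 <= f x <= 1) ->
  (forall x, f_ n x @[n --> \oo] --> f x) ->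
  fine 'E_Pr[f_ n] @[n --> \oo] --> fine 'E_Pr[f].
Proof.
move=> mf_ f_01 mf f01 f_f; apply: fine_cvg.
have If := integrable_unit_interval Pr mf f01.
rewrite fineK; last by rewrite unlock; exact: integrable_fin_num.
rewrite unlock.
apply: (@dominated_cvg _ _ _ _ _ measurableT _ _ (cst 1%E)) => //.
- by move=> n; apply/measurable_EFinP.
- by move=> x _; apply: cvg_EFin (f_f x); exact: nearW.
- by apply: finite_measure_integrable_cst.
- move=> n x _; have /andP[? ?] := f_01 n x.
  by rewrite /= lee_fin ger0_norm.
Qed.

(** * Strict concavity of the logarithm and monotonicity of the rate *)

(** This is 1 + x < exp x at x = y / u - 1, which is nonzero. *)
Lemma ln_lt_tangent (R : realType) (u y : R) :
  0 < u -> 0 < y -> y != u -> ln y < ln u + (y - u) / u.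
Proof.
move=> u0 y0 yu; have u_neq0 : u != 0 by rewrite gt_eqF.
rewrite -ltrBlDl -ln_div ?posrE //.
have yu0 : 0 < y / u by rewrite divr_gt0.
rewrite -ltr_expR lnK ?posrE // mulrBl divff //.
rewrite [ltLHS](_ : _ = 1 + (y / u - 1)); last by ring.
apply: expR_gt1Dx; rewrite subr_eq0; apply: contra yu => /eqP yu1.
by rewrite -[y](divfK u_neq0) yu1 mul1r.
Qed.

(** The point u = 1 + a / r is the mean of 1 + a and 1 with weights 1 / r and (r - 1) / r. In the
    tangent bounds at u for these two points, taken with weights 1 and r - 1, the linear terms
    cancel. *)
Lemma ln1D_lt_scale (R : realType) (r a : R) :
  1 < r -> 0 < a -> ln (1 + a) < r * ln (1 + a / r).
Proof.
move=> r1 a0; have r0 : 0 < r by lra.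
have ar0 : 0 < a / r by rewrite divr_gt0.
have ara : a / r < a by rewrite ltr_pdivrMr // ltr_pMr.
set u := 1 + a / r; have u0 : 0 < u by rewrite /u; lra.
have t1 : ln (1 + a) < ln u + (1 + a - u) / u.
  by apply: ln_lt_tangent => //; [lra | rewrite gt_eqF // /u; lra].
have t2 : 0 < ln u + (1 - u) / u.
  rewrite -[X in X < _]ln1.
  by apply: ln_lt_tangent => //; rewrite lt_eqF // /u; lra.
have t3 : 0 < (r - 1) * (ln u + (1 - u) / u) by rewrite mulr_gt0 // subr_gt0.
have -> : r * ln u = (ln u + (1 + a - u) / u) + (r - 1) * (ln u + (1 - u) / u).
  have -> : a = r * (u - 1) by rewrite /u; field; rewrite gt_eqF.
  by field; rewrite gt_eqF.
lra.
Qed.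

(* Here [g] is the channel gain, [p] the power of the user considered, [q] that
   of the other user of the pair and [m] its suppression factor. *)
Definition rate (R : realType) (b N0 m g p q w : R) : R :=
  w * logb b (1 + p * g / (N0 * w + m * q)).

Lemma sinr_ge0 (R : realType) (N0 m g p q w : R) :
  0 < N0 -> 0 < m -> 0 <= g -> 0 <= p -> 0 <= q -> 0 <= w ->
  0 <= p * g / (N0 * w + m * q).
Proof. by move=> *; rewrite divr_ge0 ?addr_ge0 ?mulr_ge0 // ltW. Qed.

Lemma rate0w (R : realType) (b N0 m g p q : R) : rate b N0 m g p q 0 = 0.
Proof. by rewrite /rate mul0r. Qed.

Lemma rate0p (R : realType) (b N0 m g q w : R) : rate b N0 m g 0 q w = 0.
Proof. by rewrite /rate /logb !mul0r addr0 ln1 mul0r mulr0. Qed.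

Lemma rate0g (R : realType) (b N0 m p q w : R) : rate b N0 m 0 p q w = 0.
Proof. by rewrite /rate /logb mulr0 !mul0r addr0 ln1 mul0r mulr0. Qed.

Lemma rate_ge0 (R : realType) (b N0 m g p q w : R) :
  1 < b -> 0 < N0 -> 0 < m -> 0 <= g -> 0 <= p -> 0 <= q -> 0 <= w ->
  0 <= rate b N0 m g p q w.
Proof.
move=> b1 N00 m0 g0 p0 q0 w0; rewrite /rate /logb.
rewrite mulr_ge0 // divr_ge0 ?ln_ge0 ?lerDl ?sinr_ge0 //.
exact: ltW.
Qed.

Lemma rate_gt0 (R : realType) (b N0 m g p q w : R) :
  1 < b -> 0 < N0 -> 0 < m -> 0 < g -> 0 < p -> 0 <= q -> 0 < w ->
  0 < rate b N0 m g p q w.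
Proof.
move=> b1 N00 m0 g0 p0 q0 w0; rewrite /rate /logb.
rewrite mulr_gt0 // divr_gt0 ?ln_gt0 // ltrDl divr_gt0 ?mulr_gt0 //.
by rewrite ltr_wpDr ?mulr_gt0 // mulr_ge0 // ltW.
Qed.

(** Scaling the whole denominator by w' / w already gives a strict gain, by [ln1D_lt_scale]. The
    true denominator at w' is no larger, since only its noise part grows with the bandwidth. *)
Lemma rate_lt_bandwidth (R : realType) (b N0 m g p q w w' : R) :
  1 < b -> 0 < N0 -> 0 < m -> 0 < g -> 0 < p -> 0 <= q -> 0 <= w < w' ->
  rate b N0 m g p q w < rate b N0 m g p q w'.
Proof.
move=> b1 N00 m0 g0 p0 q0 /andP[]; rewrite le_eqVlt => /predU1P[<-|w0] ww'.
  by rewrite rate0w rate_gt0.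
have w'0 : 0 < w' by exact: lt_trans ww'.
have pg0 : 0 < p * g by rewrite mulr_gt0.
have mq0 : 0 <= m * q by rewrite mulr_ge0 // ltW.
have D0 : 0 < N0 * w + m * q by rewrite ltr_wpDr ?mulr_gt0.
have D'0 : 0 < N0 * w' + m * q by rewrite ltr_wpDr ?mulr_gt0.
rewrite /rate /logb !mulrA ltr_pM2r ?invr_gt0 ?ln_gt0 //.
have r1 : 1 < w' / w by rewrite ltr_pdivlMr // mul1r.
apply: (@lt_le_trans _ _ (w' * ln (1 + p * g / (N0 * w + m * q) / (w' / w)))).
  have w'E : w' = w * (w' / w) by rewrite mulrC divfK // gt_eqF.
  rewrite [X in _ < X * _]w'E -[ltRHS]mulrA ltr_pM2l //.
  exact: ln1D_lt_scale r1 (divr_gt0 pg0 D0).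
rewrite ler_pM2l // ler_ln ?posrE; last 2 first.
- by rewrite addr_gt0 // !divr_gt0.
- by rewrite addr_gt0 // divr_gt0.
rewrite lerD2l -mulrA ler_pM2l // -invfM lef_pV2 ?posrE ?mulr_gt0 ?invr_gt0 //.
have -> : (N0 * w + m * q) * (w' / w) = N0 * w' + m * q * (w' / w).
  by field; rewrite gt_eqF.
by rewrite lerD2l ler_peMr // ltW.
Qed.

(** The noise N0 w > 0 is not scaled along with signal and interference, so their ratio improves
    strictly. *)
Lemma rate_lt_scale (R : realType) (b N0 m g p q w a : R) :
  1 < b -> 0 < N0 -> 0 < m -> 0 < g -> 0 < p -> 0 <= q -> 0 < w -> 1 < a ->
  rate b N0 m g p q w < rate b N0 m g (a * p) (a * q) w.
Proof.
move=> b1 N00 m0 g0 p0 q0 w0 a1; have a0 : 0 < a by lra.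
have pg0 : 0 < p * g by rewrite mulr_gt0.
have mq0 : 0 <= m * q by rewrite mulr_ge0 // ltW.
have D0 : 0 < N0 * w + m * q by rewrite ltr_wpDr ?mulr_gt0.
have D'0 : 0 < N0 * w + m * (a * q).
  by rewrite ltr_wpDr ?mulr_gt0 // mulrCA mulr_ge0 // ltW.
rewrite /rate /logb ltr_pM2l // ltr_pM2r ?invr_gt0 ?ln_gt0 //.
rewrite ltr_ln ?posrE; last 2 first.
- by rewrite addr_gt0 // divr_gt0.
- by rewrite addr_gt0 // divr_gt0 // -mulrA mulr_gt0.
rewrite ltrD2l ltr_pdivrMr // mulrAC ltr_pdivlMr //.
rewrite mulrAC -mulrA [ltRHS]mulrAC -mulrA -subr_gt0.
rewrite [ltRHS](_ : _ = p * g * ((a - 1) * (N0 * w))); last by ring.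
by rewrite !mulr_gt0 // subr_gt0.
Qed.

(** A positive limit bandwidth keeps the limit of the denominators away from 0, even if q = 0. *)
Lemma cvg_rate (R : realType) (b N0 m g p q w : R) (p_ q_ w_ : nat -> R) :
  0 < N0 -> 0 < m -> 0 <= g -> 0 <= p -> 0 <= q -> 0 < w ->
  p_ n @[n --> \oo] --> p -> q_ n @[n --> \oo] --> q ->
  w_ n @[n --> \oo] --> w ->
  rate b N0 m g (p_ n) (q_ n) (w_ n) @[n --> \oo] --> rate b N0 m g p q w.
Proof.
move=> N00 m0 g0 p0 q0 w0 cp cq cw; apply: cvgM => //; apply: cvgMl.
apply: continuous_cvg.
  apply: continuous_ln; rewrite ltr_wpDr ?ltr01 // sinr_ge0 //; exact: ltW.
apply: cvgD; first exact: cvg_cst.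
apply: cvgM; first exact: cvgMl.
apply: cvgV; first by rewrite gt_eqF // ltr_wpDr ?mulr_gt0 // mulr_ge0 // ltW.
by apply: cvgD; exact: cvgMr.
Qed.

(** * The Laplace transform of the random rate *)

Lemma measurable_expR_rate (R : realType) (d : measure_display)
    (T : measurableType d) (b N0 m c p q w : R) (g : T -> R) :
  measurable_fun setT g ->
  measurable_fun setT (fun x => expR (- (c * rate b N0 m (g x) p q w))).
Proof.
move=> mg; apply: measurableT_comp => //; apply: measurableT_comp => //.
apply: measurable_funM => //; apply: measurable_funM => //.
apply: measurable_funM => //; apply: measurableT_comp => //.
apply: measurable_funD => //; apply: measurable_funM => //.
exact: measurable_funM.
Qed.

(** At [c = theta i k * Tc] this is the reciprocal of the value [V]. *)
Definition rate_laplace (R : realType) (d : measure_display)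
    (T : measurableType d) (Pr : probability T R) (b N0 m c : R) (g : T -> R)
    (p q w : R) : R :=
  fine 'E_Pr[fun x => expR (- (c * rate b N0 m (g x) p q w))].

Section RateLaplace.
Context (R : realType) (d : measure_display) (T : measurableType d).
Context (Pr : probability T R) (b N0 m c : R) (g : T -> R).
Hypotheses (b1 : 1 < b) (N00 : 0 < N0) (m0 : 0 < m) (c0 : 0 < c).
Hypotheses (mg : measurable_fun setT g) (g0 : forall x, 0 <= g x).
Hypothesis Pg : (0 < Pr [set x | (0 < g x)%R])%E.

Let L := rate_laplace Pr b N0 m c g.

Let expR_rate01 (p q w : R) x : 0 <= p -> 0 <= q -> 0 <= w ->
  0 <= expR (- (c * rate b N0 m (g x) p q w)) <= 1.
Proof.
move=> p0 q0 w0; rewrite expR_ge0 /= -expR0 ler_expR oppr_le0.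
by rewrite mulr_ge0 ?rate_ge0 // ltW.
Qed.

Lemma rate_laplace_gt0 (p q w : R) : 0 <= p -> 0 <= q -> 0 <= w -> 0 < L p q w.
Proof.
move=> p0 q0 w0.
have -> : 0 = fine 'E_Pr[cst 0] :> R by rewrite expectation_cst.
apply: (@lt_expectation _ _ _ _ _ _ setT) => //.
- exact: measurable_expR_rate.
- by move=> x; rewrite lexx ler01.
- by move=> x; exact: expR_rate01.
- by move=> x; exact: expR_ge0.
- by move=> x _; exact: expR_gt0.
- by rewrite probability_setT.
Qed.

Let rate_laplace1 p q w :
  (forall x, rate b N0 m (g x) p q w = 0) -> L p q w = 1.
Proof.
move=> r0; rewrite /L /rate_laplace.
rewrite (_ : (fun x => _) = cst 1) ?expectation_cst //.
by apply/funext => x; rewrite r0 mulr0 oppr0 expR0.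
Qed.

Lemma rate_laplace0p q w : L 0 q w = 1.
Proof. by apply: rate_laplace1 => x; rewrite rate0p. Qed.

Lemma rate_laplace0w p q : L p q 0 = 1.
Proof. by apply: rate_laplace1 => x; rewrite rate0w. Qed.

(** The integrand drops strictly where the gain is positive, an event of positive probability by
    [Pg]; where the gain is 0 both rates vanish. *)
Lemma lt_rate_laplace (p q w p' q' w' : R) :
  0 <= p -> 0 <= q -> 0 <= w -> 0 <= p' -> 0 <= q' -> 0 <= w' ->
  (forall y, 0 < y -> rate b N0 m y p q w < rate b N0 m y p' q' w') ->
  L p' q' w' < L p q w.
Proof.
move=> p0 q0 w0 p'0 q'0 w'0 lt_r.
have lt_x x : 0 < g x -> expR (- (c * rate b N0 m (g x) p' q' w')) <
                        expR (- (c * rate b N0 m (g x) p q w)).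
  by move=> gx0; rewrite ltr_expR ltrN2 ltr_pM2l // lt_r.
apply: (@lt_expectation _ _ _ _ _ _ [set x | 0 < g x]) => //.
- exact: measurable_expR_rate.
- exact: measurable_expR_rate.
- by move=> x; exact: expR_rate01.
- by move=> x; exact: expR_rate01.
- move=> x; have := g0 x; rewrite le_eqVlt => /predU1P[<-|/lt_x/ltW //].
  by rewrite !rate0g.
- rewrite [X in measurable X](_ : _ = setT `&` g @^-1` `]0, +oo[).
    exact: mg.
  by apply/seteqP; split => x /=; rewrite in_itv /= andbT; [|case].
Qed.

Lemma rate_laplace_lt1 (p q w : R) : 0 < p -> 0 <= q -> 0 < w -> L p q w < 1.
Proof.
move=> p0 q0 w0; rewrite -(rate_laplace0p q w).
apply: lt_rate_laplace => //; try exact: ltW.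
by move=> y y0; rewrite rate0p; exact: rate_gt0.
Qed.

Lemma cvg_rate_laplace (p q w : R) (p_ q_ w_ : nat -> R) :
  0 <= p -> 0 <= q -> 0 < w ->
  (forall n, 0 <= p_ n) -> (forall n, 0 <= q_ n) -> (forall n, 0 <= w_ n) ->
  p_ n @[n --> \oo] --> p -> q_ n @[n --> \oo] --> q ->
  w_ n @[n --> \oo] --> w ->
  L (p_ n) (q_ n) (w_ n) @[n --> \oo] --> L p q w.
Proof.
move=> p0 q0 w0 p_0 q_0 w_0 cp cq cw; apply: cvg_expectation.
- by move=> n; exact: measurable_expR_rate.
- by move=> n x; exact: expR_rate01.
- exact: measurable_expR_rate.
- by move=> x; apply: expR_rate01 => //; exact: ltW.
- move=> x; apply: continuous_cvg; first exact: continuous_expR.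
  by apply: cvgN; apply: cvgMr; exact: cvg_rate.
Qed.

End RateLaplace.

(** * The flat numbering as a bijection, through quotient and remainder by K *)

Lemma flat_index_inj (K : nat) (i i' : 'I_2) (k k' : 'I_K) :
  flat_index i k = flat_index i' k' -> i = i' /\ k = k'.
Proof.
move=> /(congr1 val) /= e; have K0 : (0 < K)%N by case: K k k' e => // -[].
split; apply: val_inj.
  by have := congr1 (divn^~ K) e; rewrite !divnMDl // !divn_small // !addn0.
by have := congr1 (modn^~ K) e; rewrite !modnMDl !modn_small.
Qed.

Lemma flat_index_surj (K : nat) (j : 'I_(2 * K)) :
  exists ik : 'I_2 * 'I_K, flat_index ik.1 ik.2 = j.
Proof.
have K0 : (0 < K)%N by case: K j => [[j]|//]; rewrite muln0.
have i2 : (j %/ K < 2)%N by rewrite ltn_divLR.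
exists (Ordinal i2, Ordinal (ltn_pmod j K0)); apply: val_inj => /=.
by rewrite -divn_eq.
Qed.

(** * Values of the users and their response to bandwidth and power *)

Section Network.
Context (R : realType) (d : measure_display) (T : measurableType d).
Context (Pr : probability T R) (K : nat) (b N0 Tc Btot : R).
Context (theta mu Pmax : 'I_2 -> 'I_K -> R) (gamma : 'I_K -> {RV Pr >-> R}).
Hypotheses (hK : (0 < K)%N) (hb : 1 < b) (hN0 : 0 < N0) (hTc : 0 < Tc).
Hypothesis htheta : forall i k, 0 < theta i k.
Hypothesis hmu : forall i k, 0 < mu i k <= 1.
Hypothesis hPmax : forall i k, 0 < Pmax i k.
Hypothesis hgamma0 : forall k x, 0 <= gamma k x.
Hypothesis hgamma : forall k, (0 < Pr [set x | (0 < gamma k x)%R])%E.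

Let v := V b N0 Tc theta mu gamma.
Let m i k := mu (rev_ord i) k.
Let r i k (p : 'I_2 -> R) w y :=
  rate b N0 (m i k) y (p i) (p (rev_ord i)) w.

Let m_gt0 i k : 0 < m i k.
Proof. by case/andP: (hmu (rev_ord i) k). Qed.

Let c_gt0 i k : 0 < theta i k * Tc.
Proof. by rewrite mulr_gt0. Qed.

Let mgamma k : measurable_fun setT (gamma k).
Proof. exact: measurable_funPT. Qed.

Lemma V_rate_laplace i k (p : 'I_2 -> R) (w : R) :
  v i k p w = (rate_laplace Pr b N0 (m i k) (theta i k * Tc) (gamma k)
                 (p i) (p (rev_ord i)) w)^-1.
Proof.
congr ((fine (expectation _ _))^-1); apply/funext => x /=.
by congr expR; rewrite /rate; ring.
Qed.

Lemma V_gt0 i k (p : 'I_2 -> R) (w : R) :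
  (forall j, 0 <= p j) -> 0 <= w -> 0 < v i k p w.
Proof. by move=> p0 w0; rewrite V_rate_laplace invr_gt0 rate_laplace_gt0. Qed.

Lemma V_p0 i k (p : 'I_2 -> R) (w : R) : p i = 0 -> v i k p w = 1.
Proof. by move=> p0; rewrite V_rate_laplace p0 rate_laplace0p invr1. Qed.

Lemma V_w0 i k p : v i k p 0 = 1.
Proof. by rewrite V_rate_laplace rate_laplace0w invr1. Qed.

Lemma lt_V i k (p : 'I_2 -> R) (w : R) (p' : 'I_2 -> R) (w' : R) :
  (forall j, 0 <= p j) -> 0 <= w -> (forall j, 0 <= p' j) -> 0 <= w' ->
  (forall y, 0 < y -> r i k p w y < r i k p' w' y) ->
  v i k p w < v i k p' w'.
Proof.
move=> p0 w0 p'0 w'0 lt_r; rewrite !V_rate_laplace.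
by rewrite ltf_pV2 ?posrE ?rate_laplace_gt0 // lt_rate_laplace.
Qed.

Lemma V_gt1 i k (p : 'I_2 -> R) (w : R) :
  (forall j, 0 <= p j) -> 0 < p i -> 0 < w -> 1 < v i k p w.
Proof.
move=> p0 pi0 w0; rewrite V_rate_laplace.
by rewrite invf_gt1 ?rate_laplace_lt1 ?rate_laplace_gt0 // ltW.
Qed.

Lemma V_lt_bandwidth i k (p : 'I_2 -> R) (w w' : R) :
  (forall j, 0 <= p j) -> 0 < p i -> 0 <= w < w' -> v i k p w < v i k p w'.
Proof.
move=> p0 pi0 /[dup] ww' /andP[w0 lt_ww']; have w'0 := le_lt_trans w0 lt_ww'.
by apply: lt_V => // [|y y0]; [exact: ltW | exact: rate_lt_bandwidth].
Qed.

Lemma V_lt_scale i k (p : 'I_2 -> R) (w a : R) :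
  (forall j, 0 <= p j) -> 0 < p i -> 0 < w -> 1 < a ->
  v i k p w < v i k (fun j => a * p j) w.
Proof.
move=> p0 pi0 w0 a1; apply: lt_V => //; try exact: ltW.
  by move=> j; rewrite mulr_ge0 // ltW // (lt_trans ltr01).
by move=> y y0; exact: rate_lt_scale.
Qed.

Lemma cvg_V i k (p : 'I_2 -> R) (w : R)
    (p_ : nat -> 'I_2 -> R) (w_ : nat -> R) :
  (forall j, 0 <= p j) -> 0 < w ->
  (forall n j, 0 <= p_ n j) -> (forall n, 0 <= w_ n) ->
  (forall j, p_ n j @[n --> \oo] --> p j) -> w_ n @[n --> \oo] --> w ->
  v i k (p_ n) (w_ n) @[n --> \oo] --> v i k p w.
Proof.
move=> p0 w0 p_0 w_0 cp cw.
rewrite [X in X @ _ --> _](_ : _ = fun n =>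
    (rate_laplace Pr b N0 (m i k) (theta i k * Tc) (gamma k)
                 (p_ n i) (p_ n (rev_ord i)) (w_ n))^-1); last first.
  by apply/funext => n; rewrite V_rate_laplace.
rewrite V_rate_laplace; apply: cvgV; last exact: cvg_rate_laplace.
by rewrite gt_eqF // rate_laplace_gt0 // ltW.
Qed.

(* A silent user has the value 1 at any bandwidth, so a strict gain of the
   active users is enough: by continuity it survives giving some power to the
   silent ones and taking some bandwidth away. *)
Lemma V_lt_perturb k (u : 'I_2 -> R) (q : 'I_2 -> R) (w : R) :
  (forall i, 0 <= q i <= Pmax i k) -> 0 < w ->
  (forall i, u i = 1 \/ u i < v i k q w) ->
  exists qw : ('I_2 -> R) * R,
    [/\ forall i, 0 <= qw.1 i <= Pmax i k, 0 <= qw.2, qw.2 < w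
      & forall i, u i < v i k qw.1 qw.2].
Proof.
move=> hq w0 hu; pose h n : R := harmonic n.
have h0 n : 0 < h n by rewrite /h /= invr_gt0.
have h1 n : h n <= 1 by rewrite /h /= invf_le1 // ler1n.
(* Moving from [q] towards the power limits makes every power positive and stays within the
   limits. *)
pose q_ n i := q i * (1 - h n) + Pmax i k * h n.
(* The factor 1 / 2 keeps the bandwidth positive also at n = 0, where h n = 1. *)
pose w_ n := w * (1 - h n / 2).
have q_gt0 n i : 0 < q_ n i.
  rewrite ltr_wpDl ?mulr_gt0 // mulr_ge0 ?subr_ge0 //.
  by case/andP: (hq i).
have q_le n i : q_ n i <= Pmax i k.
  have -> : Pmax i k = Pmax i k * (1 - h n) + Pmax i k * h n by ring.
  by rewrite lerD2r ler_wpM2r ?subr_ge0 //; case/andP: (hq i).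
have w_gt0 n : 0 < w_ n by rewrite mulr_gt0 //; have := h1 n; lra.
have w_lt n : w_ n < w by rewrite gtr_pMr //; have := h0 n; lra.
have ch : h n @[n --> \oo] --> (0 : R) by exact: cvg_harmonic.
have cq i : q_ n i @[n --> \oo] --> q i.
  have -> : q i = q i * (1 - 0) + Pmax i k * 0 by ring.
  by apply: cvgD; apply: cvgMr => //; apply: cvgB => //; exact: cvg_cst.
have cw : w_ n @[n --> \oo] --> w.
  have -> : w = w * (1 - 0 / 2) by ring.
  by apply: cvgMr; apply: cvgB; [exact: cvg_cst | exact: cvgMl].
have near_i i : \forall n \near \oo, u i < v i k (q_ n) (w_ n).
  case: (hu i) => [->|ui].
    by apply: nearW => n; apply: V_gt1 => // j; exact: ltW.
  apply: cvgr_gt ui; apply: cvg_V => //.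
  - by move=> j; case/andP: (hq j).
  - by move=> n j; exact: ltW.
  - by move=> n; exact: ltW.
(* There are only two users, so one n serves both. *)
have [n hn] := filter_ex (filter_forall _ near_i).
exists (q_ n, w_ n); split => //=; last exact: ltW.
by move=> i; rewrite ltW //=.
Qed.

(** * Undominated allocations and the upper boundary *)

(** Weak Pareto optimality: only a simultaneous strict gain of all users is excluded, as in the
    notion of upper boundary point. *)
Definition undominated (P : 'I_2 -> 'I_K -> R) (Bw : 'I_K -> R) : Prop :=
  forall P' Bw', admissible Pmax Btot P' Bw' ->
  ~ forall i k, v i k (P^~ k) (Bw k) < v i k (P'^~ k) (Bw' k).

Lemma undominated_bandwidth P Bw :
  admissible Pmax Btot P Bw -> undominated P Bw -> \sum_(k < K) Bw k = Btot.
Proof.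
move=> [hP hBw hsum] und; apply/eqP; rewrite eq_le hsum /= leNgt.
apply/negP => lt_sum.
pose e := (Btot - \sum_(k < K) Bw k) / K%:R.
have K0 : 0 < K%:R :> R by rewrite ltr0n.
have e0 : 0 < e by rewrite divr_gt0 // subr_gt0.
have P0 i k : 0 <= P i k by case/andP: (hP i k).
have /choice[f hf] k : exists qw : ('I_2 -> R) * R,
    [/\ forall i, 0 <= qw.1 i <= Pmax i k, 0 <= qw.2, qw.2 < Bw k + e
      & forall i, v i k (P^~ k) (Bw k) < v i k qw.1 qw.2].
  apply: (@V_lt_perturb _ _ (P^~ k)) => //; first by rewrite ltr_wpDl.
  move=> i; have := P0 i k; rewrite le_eqVlt => /predU1P[p0|p0].
    by left; rewrite V_p0.
  by right; apply: V_lt_bandwidth; rewrite ?hBw ?ltrDl.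
apply: (und (fun i k => (f k).1 i) (fun k => (f k).2)).
  split=> [i k|k|]; [by case: (hf k) | by case: (hf k) |].
  apply: (@le_trans _ _ (\sum_(k < K) (Bw k + e))).
    by apply: ler_sum => k _; case: (hf k) => _ _ /ltW.
  rewrite big_split /= sumr_const card_ord -[e *+ K]mulr_natr.
  by rewrite divfK ?gt_eqF // subrKC.
by move=> i k; case: (hf k).
Qed.

(* If neither power of pair k0 is maximal, scaling both up leaves room to save
   bandwidth, and the saving contradicts [undominated_bandwidth]. *)
Lemma undominated_power P Bw k0 :
  admissible Pmax Btot P Bw -> undominated P Bw -> 0 < Bw k0 ->
  exists i, P i k0 = Pmax i k0.
Proof.
move=> [hP hBw hsum] und Bk0; apply: contrapT => /forallNP notmax.
have P0 i k : 0 <= P i k by case/andP: (hP i k).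
have ltP i : P i k0 < Pmax i k0.
  by rewrite lt_neqAle; case/andP: (hP i k0) => _ ->; rewrite andbT; apply/eqP.
(* Dividing by the limit instead of the power covers zero powers; (1 + t i) P stays within the limit
   because P is at most the limit. *)
pose t i := (Pmax i k0 - P i k0) / Pmax i k0.
have t0 i : 0 < t i by rewrite divr_gt0 // subr_gt0.
pose a := 1 + Num.min (t ord0) (t ord_max).
have a1 : 1 < a by rewrite ltrDl lt_min !t0.
have at_ i : a <= 1 + t i.
  rewrite lerD2l ge_min; case: i => [[|[|//]] hi].
    by rewrite (_ : Ordinal hi = ord0) ?lexx //; exact: val_inj.
  by rewrite (_ : Ordinal hi = ord_max) ?lexx ?orbT //; exact: val_inj.
have [|||[q w] /= [hq w0 ltw vlt]] := @V_lt_perturb k0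
    (fun i => v i k0 (P^~ k0) (Bw k0)) (fun i => a * P i k0) (Bw k0).
- move=> i; rewrite mulr_ge0 ?(ltW (lt_trans ltr01 a1)) //=.
  apply: (@le_trans _ _ ((1 + t i) * P i k0)); first by rewrite ler_wpM2r.
  rewrite mulrDl mul1r -lerBrDl /t mulrAC ler_pdivrMr //.
  by apply: ler_wpM2l; rewrite ?subr_ge0 ltW.
- by [].
- move=> i; have := P0 i k0; rewrite le_eqVlt => /predU1P[p0|p0].
    by left; rewrite V_p0.
  by right; apply: V_lt_scale.
pose P' i k := if k == k0 then q i else P i k.
pose B' k := if k == k0 then w else Bw k.
have le_v i k : v i k (P^~ k) (Bw k) <= v i k (P'^~ k) (B' k).
  rewrite /P' /B'; case: (k =P k0) => [->|_] //.
  exact/ltW/vlt.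
have lt_sum : \sum_(k < K) B' k < \sum_(k < K) Bw k.
  rewrite (bigD1 k0) //= [ltRHS](bigD1 k0) //= /B' eqxx ltr_leD //.
  by apply: ler_sum => k /negbTE ->.
have adm' : admissible Pmax Btot P' B'.
  split=> [i k|k|]; last exact/ltW/(lt_le_trans lt_sum).
  - by rewrite /P'; case: eqP => [->|_].
  - by rewrite /B'; case: eqP.
have und' : undominated P' B'.
  move=> P'' B'' adm'' lt''; apply: (und _ _ adm'') => i k.
  exact: le_lt_trans (le_v i k) (lt'' i k).
have := undominated_bandwidth adm' und'; apply/eqP.
by rewrite lt_eqF // (lt_le_trans lt_sum).
Qed.

(** The value vector of a dominating allocation would be a point of [G] strictly above [Vu] in every
    component. *)
Lemma upper_boundary_undominated (Vu : 'rV[R]_(2 * K)) P Bw :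
  upper_boundary_point (G b N0 Tc Btot theta mu Pmax gamma) Vu ->
  (forall i k, v i k (P^~ k) (Bw k) = Vu 0 (flat_index i k)) ->
  undominated P Bw.
Proof.
move=> [_ G0] hV P' Bw' adm' lt_v.
have P'0 i k : 0 <= P' i k by case: adm' => /(_ i k) /andP[].
have B'0 k : 0 <= Bw' k by case: adm' => _ ->.
have [f hf] := choice (@flat_index_surj K).
pose Y : 'rV[R]_(2 * K) := \row_j v (f j).1 (f j).2 (P'^~ (f j).2) (Bw' (f j).2).
have YE i k : Y 0 (flat_index i k) = v i k (P'^~ k) (Bw' k).
  by rewrite mxE; have [-> ->] := flat_index_inj (hf (flat_index i k)).
suff : set0 Y by [].
rewrite -G0; split.
  exists P', Bw'; split=> // i k.
  by rewrite YE lexx andbT ltW // V_gt0.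
split=> j; rewrite -(hf j) YE; first by rewrite ltW // V_gt0.
by rewrite -hV.
Qed.

End Network.

(** A pair without bandwidth has both values equal to 1 at any powers, so the values cannot force
    its powers to the limit. For such pairs the claim is that the powers can be chosen maximal
    without changing any value. *)
Theorem mainTheorem2 (R : realType) (d : measure_display)
    (T : measurableType d) (Pr : probability T R) (K : nat)
    (b N0 Tc Btot : R) (theta mu Pmax : 'I_2 -> 'I_K -> R)
    (gamma : 'I_K -> {RV Pr >-> R})
    (hK : (0 < K)%N) (hb : 1 < b) (hN0 : 0 < N0) (hTc : 0 < Tc)
    (hB : 0 < Btot)
    (htheta : forall i k, 0 < theta i k)
    (hmu : forall i k, 0 < mu i k <= 1)
    (hPmax : forall i k, 0 < Pmax i k)
    (hgamma0 : forall k x, 0 <= gamma k x)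
    (hgamma : forall k, (0 < Pr [set x | (0 < gamma k x)%R])%E)
    (Vu : 'rV[R]_(2 * K))
    (hVu : upper_boundary_point
             (G b N0 Tc Btot theta mu Pmax gamma) Vu)
    (P : 'I_2 -> 'I_K -> R) (Bw : 'I_K -> R)
    (hadm : admissible Pmax Btot P Bw)
    (hV : forall i k, V b N0 Tc theta mu gamma i k (P^~ k) (Bw k)
                      = Vu 0 (flat_index i k)) :
  [/\ \sum_(k < K) Bw k = Btot,
      forall k, 0 < Bw k ->
        P ord0 k = Pmax ord0 k \/ P ord_max k = Pmax ord_max k
    & exists P' : 'I_2 -> 'I_K -> R,
        [/\ admissible Pmax Btot P' Bw,
            forall i k, 0 < Bw k -> P' i k = P i k,
            forall i k, V b N0 Tc theta mu gamma i k (P'^~ k) (Bw k)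
                        = Vu 0 (flat_index i k)
          & forall k, P' ord0 k = Pmax ord0 k \/
                      P' ord_max k = Pmax ord_max k]].
Proof.
have und := upper_boundary_undominated hb hN0 hTc htheta hmu hgamma0 hVu hV.
have pmax k : 0 < Bw k ->
    P ord0 k = Pmax ord0 k \/ P ord_max k = Pmax ord_max k.
  move=> /(undominated_power hK hb hN0 hTc htheta hmu hPmax hgamma0 hgamma
    hadm und)[[[|[|//]] hi] e]; [left|right].
    by rewrite (_ : ord0 = Ordinal hi) //; exact: val_inj.
  by rewrite (_ : ord_max = Ordinal hi) //; exact: val_inj.
split=> //.
  exact: (undominated_bandwidth hK hb hN0 hTc htheta hmu hPmax hgamma0 hgamma
    hadm und).
have [hP hBw hsum] := hadm.
(* Pairs without bandwidth are set to full power, which leaves their values at 1. *)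
exists (fun i k => if 0 < Bw k then P i k else Pmax i k); split.
- by split=> // i k; case: ifP => // _; rewrite lexx ltW /=.
- by move=> i k ->.
- move=> i k; rewrite -hV /=; case: (boolP (0 < Bw k)) => // Bk0.
  have -> : Bw k = 0 by apply/eqP; rewrite eq_le hBw andbT leNgt.
  by rewrite !V_w0.
- by move=> k; case: ifPn => [/pmax//|_]; left.
Qed.
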